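(* For $A\in\mathcal{PM}(n)$, $B\in\mathcal{PM}(m)$ and $i\in[n]$ let $\mathrm{Min}_i(A,B)$ be the $(n-i)\times m$ matrix whose $j$-th column equals $A^{(i)}$ if $j$ is a minimal element of the poset associated to $B$, and is the zero column otherwise, and define $$A\circ^{\min}_i B=\begin{pmatrix}A_{11}&\mathbb{O}&\mathbb{O}\\ \mathbb{1}_m^T\otimes A_{(i)}&B&\mathbb{O}\\ A_{21}&\mathrm{Min}_i(A,B)&A_{22}\end{pmatrix}.$$ Then the maps $\circ^{\min}_i$ endow $\mathcal{PM}=\bigsqcup_{n\ge1}\mathcal{PM}(n)$ with a set operad structure, that is: (a) $A\circ^{\min}_i B\in\mathcal{PM}(n+m-1)$ for all $A\in\mathcal{PM}(n)$, $B\in\mathcal{PM}(m)$, $i\in[n]$; (b) for all $A\in\mathcal{PM}(n)$, $B\in\mathcal{PM}(m)$, $C\in\mathcal{PM}(k)$, $i\in[n]$, $j\in[m]$: $(A\circ^{\min}_i B)\circ^{\min}_{i+j-1}C=A\circ^{\min}_i(B\circ^{\min}_j C)$; (c) for all $A\in\mathcal{PM}(n)$, $B\in\mathcal{PM}(m)$, $C\in\mathcal{PM}(k)$ and $1\le i<j\le n$: $(A\circ^{\min}_i B)\circ^{\min}_{j+m-1}C=(A\circ^{\min}_j C)\circ^{\min}_i B$; (d) $[1]\circ^{\min}_1 A=A\circ^{\min}_i[1]=A$ for all $A\in\mathcal{PM}(n)$, $i\in[n]$.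
   Context: A poset matrix of order $n$ is an $n\times n$ $(0,1)$-matrix $A=[a_{st}]$ that is lower triangular with all diagonal entries $1$ and transitive ($a_{st}=a_{tu}=1\Rightarrow a_{su}=1$); $\mathcal{PM}(n)$ is the set of these. The poset associated to $B=[b_{st}]\in\mathcal{PM}(m)$ is $[m]$ with $t\le s$ iff $b_{st}=1$; so $j$ is minimal iff row $j$ of $B$ has no $1$ left of the diagonal. $A[\alpha\mid\beta]$ is the submatrix with rows $\alpha$ and columns $\beta$, $A[\alpha]=A[\alpha\mid\alpha]$. For $A\in\mathcal{PM}(n)$, $i\in[n]$: $A_{11}=A[\{1,\dots,i-1\}]$, $A_{22}=A[\{i+1,\dots,n\}]$, $A_{21}=A[\{i+1,\dots,n\}\mid\{1,\dots,i-1\}]$, $A_{(i)}=A[\{i\}\mid\{1,\dots,i-1\}]$, $A^{(i)}=A[\{i+1,\dots,n\}\mid\{i\}]$; empty blocks are vacuous. $\mathbb{1}_m^T\otimes A_{(i)}$ is the $m\times(i-1)$ matrix all of whose rows equal $A_{(i)}$. *)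

(* Defs.v *)
(* MathComp development. *)
From mathcomp Require Import all_boot all_order all_algebra.
From mathcomp Require Import zify.

Set Implicit Arguments.
Unset Strict Implicit.
Unset Printing Implicit Defensive.

(* A (0,1)-matrix is a matrix over bool, with true for 1 and false for 0.     *)
(* Rows and columns are indexed by 'I_n, so positions are counted from 0: the *)
(* 1-based position i is the ordinal of value i - 1.                          *)

Definition transitive_mx n (A : 'M[bool]_n) : bool :=
  [forall s, forall t, forall u, A s t && A t u ==> A s u].

Definition PM n : {pred 'M[bool]_n} :=
  [pred A | [&& is_trig_mx A, [forall s, A s s] & transitive_mx A]].

Arguments PM n : clear implicits.

Definition poset_le n (B : 'M[bool]_n) (t s : 'I_n) : bool := B s t.

Definition minimal n (B : 'M[bool]_n) (j : 'I_n) : bool :=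
  [forall t, poset_le B t j ==> (t == j)].

Section Blocks.
Variables (n : nat) (i : 'I_n).

Definition before : 'I_i -> 'I_n := widen_ord (ltnW (ltn_ord i)).

Definition after (s : 'I_(n - i.+1)) : 'I_n :=
  cast_ord (subnKC (ltn_ord i)) (rshift i.+1 s).

Variable A : 'M[bool]_n.

Definition block11 : 'M[bool]_i := mxsub before before A.
Definition block22 : 'M[bool]_(n - i.+1) := mxsub after after A.
Definition block21 : 'M[bool]_(n - i.+1, i) := mxsub after before A.
Definition lower_row : 'rV[bool]_i := mxsub (fun=> i) before A.
Definition lower_col : 'cV[bool]_(n - i.+1) := mxsub after (fun=> i) A.

Definition Min m (B : 'M[bool]_m) : 'M[bool]_(n - i.+1, m) :=
  \matrix_(s, j) (if minimal B j then lower_col s ord0 else false).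

End Blocks.

Lemma comp_size n m (i : 'I_n) : i + (m + (n - i.+1)) = n + m - 1.
Proof. by have := ltn_ord i; lia. Qed.

Definition comp_min n m (A : 'M[bool]_n) (i : 'I_n) (B : 'M[bool]_m) :
    'M[bool]_(n + m - 1) :=
  castmx (comp_size m i, comp_size m i)
    (block_mx (block11 i A)                     (row_mx 0%R 0%R)
              (col_mx (\matrix_(_ < m) lower_row i A)
                      (block21 i A))            (block_mx B         0%R
                                                          (Min i A B) (block22 i A))).

Definition one_mx : 'M[bool]_1 := const_mx true.

(* The 1-based position i + j - 1 has 0-based value i + j. *)
Lemma seq_pos_subproof n m (i : 'I_n) (j : 'I_m) : i + j < n + m - 1.
Proof. by have := ltn_ord i; have := ltn_ord j; lia. Qed.

Definition seq_pos n m (i : 'I_n) (j : 'I_m) : 'I_(n + m - 1) :=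
  Ordinal (seq_pos_subproof i j).

(* For i < j: inserting m rows at i moves position j up by m - 1 in either    *)
(* numbering (shift_pos), and inserting k rows at j leaves position i where   *)
(* it is (keep_pos).                                                          *)
Lemma shift_pos_subproof n m (j : 'I_n) : 0 < m -> j + m - 1 < n + m - 1.
Proof. by have := ltn_ord j; lia. Qed.

Definition shift_pos n m (m_gt0 : 0 < m) (j : 'I_n) : 'I_(n + m - 1) :=
  Ordinal (shift_pos_subproof j m_gt0).

Lemma keep_pos_subproof n k (i : 'I_n) : 0 < k -> i < n + k - 1.
Proof. by have := ltn_ord i; lia. Qed.

Definition keep_pos n k (k_gt0 : 0 < k) (i : 'I_n) : 'I_(n + k - 1) :=
  Ordinal (keep_pos_subproof i k_gt0).

(* A matrix as an element of the disjoint union over all orders. Orders such  *)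
(* as (n + m - 1) + k - 1 and n + (m + k - 1) - 1 are equal but not           *)
(* convertible; an equation in the union asserts equal order and equal        *)
(* matrices.                                                                  *)
Definition in_union n (A : 'M[bool]_n) : {n : nat & 'M[bool]_n} :=
  existT (fun n => 'M[bool]_n) n A.

(* Main.v *)
Require Import Defs.
From mathcomp Require Import all_boot all_order all_algebra.
From mathcomp Require Import zify.

Set Implicit Arguments.
Unset Strict Implicit.
Unset Printing Implicit Defensive.

(* Extend every matrix by [false] to a relation on [nat].  The composite
    A o_i B is then the pullback of A along the map collapsing the inserted
    interval [i, i + m[ to i, except that B is used inside the interval and
    that a column of the interval coming from a non-minimal element of B is
    erased outside of it.  As j is minimal in A o_i B exactly when its image is
    minimal in A and, if j is inserted, j - i is minimal in B, the two laws of
    associativity reduce to the way the collapsing maps compose. *)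

Definition mxrel n (A : 'M[bool]_n) : rel nat := fun s t =>
  if insub s is Some s' then if insub t is Some t' then A s' t' else false
  else false.

(** Testing only below [j] keeps the test bounded on [nat]; for a triangular relation this is
    minimality in the poset. *)
Definition minrel (b : rel nat) (j : nat) : bool :=
  all (fun t => ~~ b j t) (iota 0 j).

Definition inserted (i m s : nat) : bool := i <= s < i + m.

(** The truncated subtraction is 0 up to the end of the interval, so for [0 < m] the value is [s]
    before the interval, [i] on it and [s - (m - 1)] after it. This closed form stays within reach
    of [lia]. *)
Definition collapse (i m s : nat) : nat :=
  minn s i + (s.+1 - (i + m)).

Definition comp_rel (i m : nat) (a b : rel nat) : rel nat := fun s t =>
  if inserted i m s && inserted i m t then b (s - i) (t - i)
  else a (collapse i m s) (collapse i m t) &&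
       (inserted i m t ==> minrel b (t - i)).

Definition trig_rel (a : rel nat) : Prop := forall s t, s < t -> a s t = false.

Ltac collapse_lia :=
  rewrite /collapse /inserted; lia.

Lemma minrelP (b : rel nat) (j : nat) :
  reflect (forall t, t < j -> b j t = false) (minrel b j).
Proof.
apply: (iffP allP) => H t.
  by move=> ltj; apply/negbTE/H; rewrite mem_iota.
by rewrite mem_iota => ltj; rewrite H.
Qed.

(** * Dictionary between matrices and relations on [nat] *)

Lemma eq_mxrel n (A : 'M[bool]_n) (x y : 'I_n) (s t : nat) :
  x = s :> nat -> y = t :> nat -> A x y = mxrel A s t.
Proof. by move=> <- <-; rewrite /mxrel !valK. Qed.

Lemma mxrel_size n (A : 'M[bool]_n) (s t : nat) :
  mxrel A s t -> s < n /\ t < n.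
Proof. by rewrite /mxrel; case: insubP => // s' -> _; case: insubP. Qed.

Lemma mxrel_geq n (A : 'M[bool]_n) (s t : nat) :
  (n <= s) || (n <= t) -> mxrel A s t = false.
Proof.
by move=> out; apply/negP => /mxrel_size [ltsn lttn]; move: out; lia.
Qed.

(** The type of [mxrel] does not mention the order, so matrices whose orders are equal but not
    convertible can be compared entry by entry, without transport. *)
Lemma in_union_eq n n' (A : 'M[bool]_n) (A' : 'M[bool]_n') :
  n = n' -> (forall s t, mxrel A s t = mxrel A' s t) ->
  in_union A = in_union A'.
Proof.
move=> eqn; case: n' / eqn A' => A' eqA; congr in_union.
by apply/matrixP => x y; rewrite !(eq_mxrel _ (erefl _) (erefl _)).
Qed.

Lemma PMP n (A : 'M[bool]_n) :
  reflect [/\ trig_rel (mxrel A), forall s, s < n -> mxrel A s s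
            & forall s t u, mxrel A s t -> mxrel A t u -> mxrel A s u]
          (A \in PM n).
Proof.
apply: (iffP and3P).
  case=> /is_trig_mxP trigA /forallP reflA /forallP transA; split.
  - move=> s t ltst; case: (ltnP t n) => [lttn|letn]; last first.
      by rewrite mxrel_geq // letn orbT.
    have ltsn := ltn_trans ltst lttn.
    by rewrite -(@eq_mxrel _ A (Ordinal ltsn) (Ordinal lttn)) // trigA.
  - by move=> s ltsn; rewrite -(@eq_mxrel _ A (Ordinal ltsn) (Ordinal ltsn)).
  - move=> s t u Ast Atu.
    have [ltsn lttn] := mxrel_size Ast.
    have [_ ltun] := mxrel_size Atu.
    move: Ast Atu.
    rewrite -(@eq_mxrel _ A (Ordinal ltsn) (Ordinal lttn)) //.
    rewrite -(@eq_mxrel _ A (Ordinal lttn) (Ordinal ltun)) //.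
    rewrite -(@eq_mxrel _ A (Ordinal ltsn) (Ordinal ltun)) // => Ast Atu.
    have /forallP/(_ (Ordinal lttn))/forallP/(_ (Ordinal ltun)) :=
      transA (Ordinal ltsn).
    by rewrite Ast Atu.
case=> trigA reflA transA; split.
- apply/is_trig_mxP => s t ltst.
  by rewrite (eq_mxrel _ (erefl _) (erefl _)) trigA.
- by apply/forallP => s; rewrite (eq_mxrel _ (erefl _) (erefl _)) reflA.
- apply/forallP => s; apply/forallP => t; apply/forallP => u; apply/implyP.
  rewrite !(eq_mxrel _ (erefl _) (erefl _)) => /andP[]; exact: transA.
Qed.

Lemma minimal_mxrel n (B : 'M[bool]_n) (j : 'I_n) :
  trig_rel (mxrel B) -> minimal B j = minrel (mxrel B) j.
Proof.
move=> trigB; apply/forallP/minrelP => [minj t ltj|minj t].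
  have := minj (Ordinal (ltn_trans ltj (ltn_ord j))); rewrite /poset_le.
  rewrite (@eq_mxrel _ B j _ j t) // -val_eqE /= (ltn_eqF ltj).
  by rewrite implybF => /negbTE.
rewrite /poset_le (eq_mxrel _ (erefl _) (erefl _)) -val_eqE /=.
by case: (ltngtP t j) => [/minj -> //|/trigB -> //|]; rewrite implybT.
Qed.

(** * Minimal elements and associativity for relational composites *)

Lemma minrel_comp (i m : nat) (a b : rel nat) (t : nat) : 0 < m ->
  minrel (comp_rel i m a b) t =
  minrel a (collapse i m t) && (inserted i m t ==> minrel b (t - i)).
Proof.
move=> m_gt0; apply/minrelP/andP; last first.
  move=> [/minrelP mina /implyP minb] u ltut; rewrite /comp_rel.
  case: ifP => [/andP[int inu]|].
    by move/minrelP: (minb int) => ->; move: int inu; rewrite /inserted; lia.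
  move=> out; rewrite mina //.
  by move: out; collapse_lia.
move=> mint; split; last first.
  apply/implyP => int; apply/minrelP => v ltv.
  have := mint (i + v); rewrite /comp_rel int addKn.
  have -> : inserted i m (i + v) by move: int; rewrite /inserted; lia.
  by apply; move: int; rewrite /inserted; lia.
(* Every [v] below the image of [t] lifts to some [u < t] whose column survives, so erasing columns
   makes no new element minimal. *)
apply/minrelP => v ltv.
(* The column of the first inserted element is never erased: [minrel b 0]. *)
pose u := if v <= i then v else v + m - 1.
have ltut : u < t by move: ltv; rewrite /u; case: (leqP v i) => ?; collapse_lia.
have colu : collapse i m u = v.
  by rewrite /u; case: (leqP v i) => ?; collapse_lia.
have := mint u ltut; rewrite /comp_rel colu.
have -> : inserted i m t && inserted i m u = false.
  move: ltv; rewrite /u; case: (leqP v i) => ?; collapse_lia.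
suff -> : inserted i m u ==> minrel b (u - i) by rewrite andbT.
apply/implyP => inu; suff -> : u - i = 0 by [].
by move: inu; rewrite /u; case: (leqP v i) => ?; rewrite /inserted; lia.
Qed.

(** The interval of [c] lies inside the enlarged interval of length [m + k - 1], and collapsing the
    small one and then what remains of the large one amounts to collapsing the large one at once. *)
Lemma comp_rel_seq (i j m k : nat) (a b c : rel nat) (s t : nat) :
  j < m -> 0 < k ->
  comp_rel (i + j) k (comp_rel i m a b) c s t =
  comp_rel i (m + k - 1) a (comp_rel j k b c) s t.
Proof.
move=> ltjm k_gt0.
have inE x : inserted (i + j) k x =
    inserted i (m + k - 1) x && inserted j k (x - i).
  by rewrite /inserted; lia.
have inC x : inserted i m (collapse (i + j) k x) = inserted i (m + k - 1) x.
  by collapse_lia.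
have colC x : collapse i m (collapse (i + j) k x) = collapse i (m + k - 1) x.
  by collapse_lia.
have colB x : inserted i (m + k - 1) x ->
    collapse (i + j) k x - i = collapse j k (x - i).
  by collapse_lia.
rewrite {1 2}/comp_rel !inE !inC !colC !subnDA {1}/comp_rel.
(* Minimality in the composite of [b] and [c] splits into the two conditions that the left side
   imposes one after the other. *)
rewrite minrel_comp //.
case Xs: (inserted i _ s); case Xt: (inserted i _ t) => //=.
- by rewrite {1}/comp_rel !colB.
- by rewrite andbF /= !andbT.
- by rewrite colB // -andbA.
- by rewrite !andbT.
Qed.

(** As [i < j], the two intervals are disjoint and their collapses commute up to the shift by
    [m - 1]. No element is in both, so the two erasures do not interact. *)
Lemma comp_rel_par (i j m k : nat) (a b c : rel nat) (s t : nat) :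
  i < j -> 0 < m -> 0 < k ->
  comp_rel (j + m - 1) k (comp_rel i m a b) c s t =
  comp_rel i m (comp_rel j k a c) b s t.
Proof.
move=> ltij m_gt0 k_gt0.
have inC x : inserted j k (collapse i m x) = inserted (j + m - 1) k x.
  by collapse_lia.
have inB x : inserted i m (collapse (j + m - 1) k x) = inserted i m x.
  by collapse_lia.
have colC x : collapse i m (collapse (j + m - 1) k x) =
    collapse j k (collapse i m x).
  by collapse_lia.
have subC x : inserted (j + m - 1) k x ->
    x - (j + m - 1) = collapse i m x - j.
  by collapse_lia.
have subB x : inserted i m x -> collapse (j + m - 1) k x - i = x - i.
  by collapse_lia.
have disj x : inserted i m x -> inserted (j + m - 1) k x = false.
  by rewrite /inserted; lia.
rewrite /comp_rel !inB !inC !colC.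
case Xs: (inserted i m s); case Xt: (inserted i m t);
  rewrite ?(disj _ Xs) ?(disj _ Xt) ?andbF ?andbT ?subB //=.
- by case Yt: (inserted _ _ t); rewrite ?(subC _ Yt).
- by case Ys: (inserted _ _ s); case Yt: (inserted _ _ t);
    rewrite ?(subC _ Ys) ?(subC _ Yt).
Qed.

(** * The block matrix as a relational composite *)

Lemma comp_rel_out (i m : nat) (a b : rel nat) (s t : nat) :
  inserted i m t = false ->
  comp_rel i m a b s t = a (collapse i m s) (collapse i m t).
Proof. by rewrite /comp_rel => ->; rewrite andbF andbT. Qed.

(** Handles the zero blocks: on the interval [collapse] is constant, so distinct images rule out the
    branch that uses [b]. *)
Lemma comp_rel_trigl (i m : nat) (a b : rel nat) (s t : nat) :
  trig_rel a -> collapse i m s < collapse i m t ->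
  comp_rel i m a b s t = false.
Proof.
move=> triga ltst; rewrite /comp_rel triga //; case: ifP => // /andP[].
by move: ltst; collapse_lia.
Qed.

Lemma mxrel_comp n m (A : 'M[bool]_n) (B : 'M[bool]_m) (i : 'I_n) (s t : nat) :
  0 < m -> A \in PM n -> B \in PM m ->
  mxrel (comp_min A i B) s t = comp_rel i m (mxrel A) (mxrel B) s t.
Proof.
move=> m_gt0 /PMP[trigA _ _] /PMP[trigB _ _]; have ltin := ltn_ord i.
case: (ltnP s (n + m - 1)) => [lts|les]; last first.
  rewrite mxrel_geq ?les // /comp_rel (_ : inserted i m s = false) /=.
    by rewrite mxrel_geq //; collapse_lia.
  by rewrite /inserted; lia.
case: (ltnP t (n + m - 1)) => [ltt|let_]; last first.
  rewrite mxrel_geq ?let_ ?orbT // /comp_rel.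
  rewrite (_ : inserted i m t = false) /= ?andbF.
    by rewrite mxrel_geq //; collapse_lia.
  by rewrite /inserted; lia.
rewrite -(@eq_mxrel _ _ (Ordinal lts) (Ordinal ltt)) //.
rewrite castmxE mxE.
case: splitP => s' /= Hs; rewrite !mxE; case: splitP => t' /= Ht; rewrite ?mxE.
all: try (case: splitP => s'' /= Hs'; rewrite ?mxE).
all: try (case: splitP => t'' /= Ht'; rewrite ?mxE).
all: try have lts' := ltn_ord s'; try have ltt' := ltn_ord t'.
all: try have lts'' := ltn_ord s''; try have ltt'' := ltn_ord t''.
(* The blocks come in the order 11, 12, 13, 21, 31, 22, 23, 32, 33; [Min] is block 32. *)
- by rewrite comp_rel_out; [apply: eq_mxrel => /=|]; collapse_lia.
- by rewrite comp_rel_trigl //; collapse_lia.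
- by rewrite comp_rel_trigl //; collapse_lia.
- by rewrite comp_rel_out; [apply: eq_mxrel => /=|]; collapse_lia.
- by rewrite comp_rel_out; [apply: eq_mxrel => /=|]; collapse_lia.
- rewrite /comp_rel (_ : inserted i m s); last by rewrite /inserted; lia.
  rewrite (_ : inserted i m t); last by rewrite /inserted; lia.
  by apply: eq_mxrel; lia.
- by rewrite comp_rel_trigl //; collapse_lia.
- rewrite /comp_rel (_ : inserted i m s = false); last by rewrite /inserted; lia.
  rewrite (_ : inserted i m t) /=; last by rewrite /inserted; lia.
  rewrite minimal_mxrel // (_ : t - i = t''); last by lia.
  case: ifP => _; last by rewrite andbF.
  by rewrite andbT; apply: eq_mxrel => /=; collapse_lia.
- by rewrite comp_rel_out; [apply: eq_mxrel => /=|]; collapse_lia.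
Qed.

(** * The composite is again a poset matrix *)

Lemma comp_rel_trig (i m : nat) (a b : rel nat) :
  trig_rel a -> trig_rel b -> trig_rel (comp_rel i m a b).
Proof.
move=> trigA trigB s t ltst; rewrite /comp_rel; case: ifP => out.
  by apply: trigB; move: out; rewrite /inserted; lia.
by rewrite trigA //; move: out; collapse_lia.
Qed.

Lemma comp_rel_trans (i m : nat) (a b : rel nat) :
  0 < m -> trig_rel a -> trig_rel b ->
  (forall s t u, a s t -> a t u -> a s u) ->
  (forall s t u, b s t -> b t u -> b s u) ->
  forall s t u, comp_rel i m a b s t -> comp_rel i m a b t u ->
    comp_rel i m a b s u.
Proof.
move=> m_gt0 triga trigb transa transb s t u; rewrite /comp_rel.
have colE x : inserted i m x -> collapse i m x = i by collapse_lia.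
case Xs: (inserted i m s); case Xt: (inserted i m t);
  case Xu: (inserted i m u); rewrite /= ?andbT
    ?(colE _ Xs) ?(colE _ Xt) ?(colE _ Xu).
- exact: transb.
- by [].
(* An outside [t] between two inserted elements would be related to [i] in both directions;
   triangularity forces its image to be [i], which only inserted elements have. *)
- move=> ait /andP[ati _]; case: (ltngtP (collapse i m t) i) => [lt|lt|eqt].
  + by rewrite triga in ati.
  + by rewrite triga in ait.
  + by move: Xt eqt; collapse_lia.
- exact: transa.
(* The column of [t] survives, so [t] is minimal in [b]; being above [u] it equals [u], whose column
   therefore survives too. *)
- move=> /andP[-> /minrelP mint] btu.
  case: (ltngtP (t - i) (u - i)) => [lt|lt|<-].
  + by rewrite trigb in btu.
  + by rewrite mint in btu.
  + exact/minrelP.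
- by case/andP=> + _; exact: transa.
- by move=> ast /andP[atu ->]; rewrite andbT; exact: transa atu.
- exact: transa.
Qed.

Lemma comp_min_PM n m (A : 'M[bool]_n) (B : 'M[bool]_m) (i : 'I_n) :
  0 < m -> A \in PM n -> B \in PM m -> comp_min A i B \in PM (n + m - 1).
Proof.
move=> m_gt0 PA PB; have ltin := ltn_ord i.
have compE s t := mxrel_comp i s t m_gt0 PA PB.
have /PMP[trigA reflA transA] := PA; have /PMP[trigB reflB transB] := PB.
apply/PMP; split=> [s t ltst|s lts|s t u].
- by rewrite compE comp_rel_trig.
- rewrite compE /comp_rel andbb; case: (boolP (inserted i m s)) => ins.
    by apply: reflB; move: ins; rewrite /inserted; lia.
  by rewrite andbT; apply: reflA; move: ins; collapse_lia.
- by rewrite !compE; apply: comp_rel_trans.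
Qed.

(** Replaces function extensionality when [mxrel_comp] has to be applied to an inner composite,
    which occurs as an unapplied relation. *)
Lemma eq_comp_rel (i m : nat) (a a' b b' : rel nat) :
  a =2 a' -> b =2 b' -> comp_rel i m a b =2 comp_rel i m a' b'.
Proof.
move=> eqa eqb s t; rewrite /comp_rel eqa eqb.
congr (if _ then _ else _ && (_ ==> _)).
by apply: eq_all => x; rewrite eqb.
Qed.

(** * The unit and the operad axioms *)

Lemma one_mx_PM : one_mx \in PM 1.
Proof.
apply/and3P; split.
- by apply/is_trig_mxP => s t; rewrite !ord1.
- by apply/forallP => s; rewrite mxE.
- by apply/forallP => s; apply/forallP => t; apply/forallP => u; rewrite !mxE.
Qed.

Theorem theorem3 :
  [/\ (* (a) *)
      forall (n m : nat) (n_gt0 : 0 < n) (m_gt0 : 0 < m)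
        (A : 'M[bool]_n) (B : 'M[bool]_m) (i : 'I_n),
        A \in PM n -> B \in PM m -> comp_min A i B \in PM (n + m - 1),
      (* (b) *)
      forall (n m k : nat) (n_gt0 : 0 < n) (m_gt0 : 0 < m) (k_gt0 : 0 < k)
        (A : 'M[bool]_n) (B : 'M[bool]_m) (C : 'M[bool]_k)
        (i : 'I_n) (j : 'I_m),
        A \in PM n -> B \in PM m -> C \in PM k ->
        in_union (comp_min (comp_min A i B) (seq_pos i j) C) =
        in_union (comp_min A i (comp_min B j C)),
      (* (c) *)
      forall (n m k : nat) (n_gt0 : 0 < n) (m_gt0 : 0 < m) (k_gt0 : 0 < k)
        (A : 'M[bool]_n) (B : 'M[bool]_m) (C : 'M[bool]_k) (i j : 'I_n),
        A \in PM n -> B \in PM m -> C \in PM k -> i < j ->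
        in_union (comp_min (comp_min A i B) (shift_pos m_gt0 j) C) =
        in_union (comp_min (comp_min A j C) (keep_pos k_gt0 i) B)
    & (* (d) *)
      forall (n : nat) (n_gt0 : 0 < n) (A : 'M[bool]_n) (i : 'I_n),
        A \in PM n ->
        in_union (comp_min one_mx ord0 A) = in_union A /\
        in_union (comp_min A i one_mx) = in_union A].
Proof.
split.
- by move=> n m _ m_gt0 A B i; apply: comp_min_PM.
- move=> n m k _ m_gt0 k_gt0 A B C i j PA PB PC.
  have ltjm := ltn_ord j; apply: in_union_eq => [|s t]; first by lia.
  have mk_gt0 : 0 < m + k - 1 by lia.
  rewrite !mxrel_comp ?comp_min_PM //.
  rewrite (@eq_comp_rel _ _ _ _ _ (mxrel C)
    (fun x y => mxrel_comp i x y m_gt0 PA PB)) //=.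
  rewrite comp_rel_seq //; apply: eq_comp_rel => // x y.
  by rewrite mxrel_comp.
- move=> n m k _ m_gt0 k_gt0 A B C i j PA PB PC ltij.
  apply: in_union_eq => [|s t]; first by lia.
  rewrite !mxrel_comp ?comp_min_PM //.
  rewrite (@eq_comp_rel _ _ _ _ _ (mxrel C)
    (fun x y => mxrel_comp i x y m_gt0 PA PB)) //=.
  rewrite comp_rel_par //; apply: eq_comp_rel => // x y.
  by rewrite mxrel_comp.
- move=> n n_gt0 A i PA; have ltin := ltn_ord i.
  have /PMP[trigA reflA _] := PA.
  split; (apply: in_union_eq => [|s t]; first by lia).
  + rewrite mxrel_comp ?one_mx_PM // /comp_rel /= !subn0.
    (* The interval is all of [[0, n[]; a position beyond it collapses to at least 1, outside
       [one_mx]. *)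
    case: ifP => // out.
    have outA : (n <= s) || (n <= t) by move: out; rewrite /inserted; lia.
    rewrite [RHS]mxrel_geq // mxrel_geq //.
    by move: outA; collapse_lia.
  + rewrite mxrel_comp ?one_mx_PM // /comp_rel.
    have colE x : collapse i 1 x = x by collapse_lia.
    have inE x : inserted i 1 x = (x == i :> nat) by rewrite /inserted; lia.
    rewrite !colE !inE.
    (* Column [i] is kept because 0 is minimal in [one_mx]; only the entry at [(i, i)] is replaced,
       by a 1 that agrees with reflexivity of [A]. *)
    case: (eqVneq t i) => [->|_]; last by rewrite andbF andbT.
    case: (eqVneq s i) => [->|_]; rewrite /= subnn ?andbT //.
    by rewrite -(@eq_mxrel _ _ ord0 ord0) // mxE reflA.
Qed.
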